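(* Let $(\overline{M},\overline{\phi},\zeta,\eta,\overline{g})$ be an indefinite Sasakian manifold. There does not exist any screen locally conformal (coisotropic) null submanifold $(M,g,S(TM))$ of $\overline{M}$ that is tangent to the structure vector field $\zeta$. That is, there is no coisotropic null submanifold $M$ with $\zeta\in\Gamma(TM)$, with screen distribution $S(TM)$ as in the standing assumptions, for which there are smooth functions $\varphi_i$ ($i\in\{1,\ldots,r\}$) on the coordinate neighbourhoods $\mathcal{U}$ of $M$ such that $$h_i^*(X,PY)=\varphi_i\,h_i^l(X,Y),\qquad \forall\, X,Y\in\Gamma(TM|_{\mathcal{U}}),\ i\in\{1,\ldots,r\}.$$
   Context: Indefinite Sasakian manifold: an odd-dimensional semi-Riemannian manifold $(\overline{M},\overline{g})$ of constant index $\nu>0$ with a $(1,1)$-tensor field $\overline{\phi}$, a vector field $\zeta$ (structure or characteristic vector field) and a 1-form $\eta$ such that $\overline{\phi}^2X=-X+\eta(X)\zeta$, $\overline{\phi}\zeta=0$, $\eta\circ\overline{\phi}=0$, $\eta(\zeta)=1$, $\overline{g}(\overline{\phi}X,\overline{\phi}Y)=\overline{g}(X,Y)-\eta(X)\eta(Y)$, $\eta(X)=\overline{g}(\zeta,X)$, and $(\overline{\nabla}_X\overline{\phi})Y=\overline{g}(X,Y)\zeta-\eta(Y)X$ for all vector fields $X,Y$, where $\overline{\nabla}$ is the Levi-Civita connection of $\overline{g}$. Null submanifolds: let $\dim\overline{M}=m+n$, $\dim M=m$, $m,n\ge1$, and let $g=\overline{g}|_{TM}$ be degenerate. The radical distribution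 is $\mathrm{Rad}\,TM=TM\cap TM^{\perp}$, assumed a smooth distribution of rank $r>0$. $M$ is coisotropic if $1\le r=n<m$. A screen distribution $S(TM)$ is a (non-unique, non-degenerate) complement: $TM=\mathrm{Rad}\,TM\perp S(TM)$; $P$ denotes the projection of $TM$ onto $S(TM)$. For a local frame $\{\xi_1,\dots,\xi_r\}$ of $\mathrm{Rad}\,TM$ on $\mathcal{U}\subset M$ there are local sections $N_1,\dots,N_r$ of $S(TM)^\perp$ (in $T\overline{M}|_M$) with $\overline{g}(\xi_i,N_j)=\delta_{ij}$, $\overline{g}(N_i,N_j)=0$; they span the null transversal bundle $l\mathrm{tr}(TM)$, and $T\overline{M}|_M=TM\oplus l\mathrm{tr}(TM)$ when $M$ is coisotropic. The local null fundamental forms $h_i^l$ of $M$, and the local second fundamental forms $h_i^*$ of $S(TM)$, are defined by $$\overline{\nabla}_XY=\nabla_XY+\sum_{i=1}^r h_i^l(X,Y)N_i,\qquad \nabla_XPY=\nabla^*_XPY+\sum_{i=1}^r h_i^*(X,PY)\xi_i,$$ for $X,Y\in\Gamma(TM)$, with $\nabla_XY\in\Gamma(TM)$ and $\nabla^*_XPY\in\Gamma(S(TM))$. Standing assumptions: $\zeta$ is tangent to $M$, $S(TM)$ is chosen so that $\zeta\in\Gamma(S(TM))$, and $\overline{\phi}\,\mathrm{Rad}\,TM$ and $\overline{\phi}\,l\mathrm{tr}(TM)$ are subbundles of $S(TM)$, so that $S(TM)=\{\overline{\phi}\,\mathrm{Rad}\,TM\oplus\overline{\phi}\,l\mathrm{tr}(TM)\}\perp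 D_0\perp\mathbb{R}\zeta$ with $D_0$ a non-degenerate $\overline{\phi}$-invariant distribution. *)

(* Defs.v *)
From HB Require Import structures.
From mathcomp Require Import all_boot all_order all_algebra.
From mathcomp Require Import sesquilinear.
From mathcomp Require Import all_classical all_reals all_analysis.

Set Implicit Arguments.
Unset Strict Implicit.
Unset Printing Implicit Defensive.

Import Order.TTheory GRing.Theory Num.Theory.
Import numFieldNormedType.Exports.

Local Open Scope classical_set_scope.
Local Open Scope ring_scope.

(* In finite dimension, [f] is C^k on the open set [A]. *)
Fixpoint Ck (R : realType) (V W : normedModType R) (k : nat)
    (A : set V) (f : V -> W) : Prop :=
  if k is k'.+1 then
    (forall x, A x -> differentiable f x) /\
    (forall v, Ck k' A (fun x => 'd f x v))
  else forall x, A x -> {for x, continuous f}.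

Definition smooth_on (R : realType) (V W : normedModType R)
    (A : set V) (f : V -> W) : Prop :=
  forall k, Ck k A f.

(** * Smooth manifolds *)

(* The values of [cfun] off [cdom], and of [cinv] off [cfun @` cdom], are
   irrelevant. *)
Record chart (R : realType) (d : nat) (T : topologicalType) := Chart {
  cdom : set T;
  cfun : T -> 'rV[R]_d;
  cinv : 'rV[R]_d -> T;
  cdom_open : open cdom;
  cimg_open : open (cfun @` cdom);
  cfunK : forall p, cdom p -> cinv (cfun p) = p;
  cfun_cts : forall p, cdom p -> {for p, continuous cfun};
  cinv_cts : forall x, (cfun @` cdom) x -> {for x, continuous cinv} }.

(* [chart_at p] is a chosen chart around [p]; it only serves to give names to
   the tangent vectors at [p], see [tangent]. *)
Record manifold (R : realType) (d : nat) := Manifold {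
  carrier :> topologicalType;
  atlas : set (chart R d carrier);
  chart_at : carrier -> chart R d carrier;
  carrier_hausdorff : hausdorff_space carrier;
  carrier_second_countable : @second_countable carrier;
  carrier_nonempty : [set: carrier] !=set0;
  chart_at_atlas : forall p, atlas (chart_at p);
  chart_at_dom : forall p, cdom (chart_at p) p;
  atlas_smooth : forall c c', atlas c -> atlas c' ->
    smooth_on (cfun c @` (cdom c `&` cdom c')) (cfun c' \o cinv c) }.

(* An open subset of the domain of a chart is the domain of the restricted
   chart, hence a coordinate neighbourhood. *)
Definition coordinate_nbhd (R : realType) (d : nat) (M : manifold R d)
    (U : set M) : Prop :=
  open U /\ exists2 c, atlas (m := M) c & U `<=` cdom c.

(* A tangent vector at [p] is represented by its components in the chart
   [chart_at p]; [tcoord c] gives its components in another chart [c]. *)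
Definition tangent (R : realType) (d : nat) (M : manifold R d) (p : M) :
  vectType R := 'rV[R]_d.

Definition tcoord (R : realType) (d : nat) (M : manifold R d)
    (c : chart R d M) (p : M) (v : tangent p) : 'rV[R]_d :=
  'd (cfun c \o cinv (chart_at p)) (cfun (chart_at p) p) v.

Definition vector_field (R : realType) (d : nat) (M : manifold R d) : Type :=
  forall p : M, tangent p.

Definition smooth_fun (R : realType) (d : nat) (M : manifold R d)
    (A : set M) (f : M -> R) : Prop :=
  forall c, atlas (m := M) c ->
    smooth_on (cfun c @` (A `&` cdom c)) (f \o cinv c : 'rV[R]_d -> R^o).

Definition smooth_field (R : realType) (d : nat) (M : manifold R d)
    (A : set M) (X : vector_field M) : Prop :=
  forall c, atlas (m := M) c ->
    smooth_on (cfun c @` (A `&` cdom c))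
      (fun x => tcoord c (X (cinv c x))).

Definition dirder (R : realType) (d : nat) (M : manifold R d)
    (p : M) (v : tangent p) (f : M -> R) : R :=
  'd (f \o cinv (chart_at p) : 'rV[R]_d -> R^o) (cfun (chart_at p) p) v.

Definition smooth_map (R : realType) (m d : nat) (M : manifold R m)
    (N : manifold R d) (F : M -> N) : Prop :=
  continuous F /\
  forall c c', atlas (m := M) c -> atlas (m := N) c' ->
    smooth_on (cfun c @` (cdom c `&` F @^-1` cdom c'))
      (cfun c' \o F \o cinv c).

Definition tangent_map (R : realType) (m d : nat) (M : manifold R m)
    (N : manifold R d) (F : M -> N) (p : M) :
    'Hom(tangent p, tangent (F p)) :=
  linfun ('d (cfun (chart_at (F p)) \o F \o cinv (chart_at p))
             (cfun (chart_at p) p) : 'rV[R]_m -> 'rV[R]_d).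

Definition immersion (R : realType) (m d : nat) (M : manifold R m)
    (N : manifold R d) (F : M -> N) : Prop :=
  smooth_map F /\ forall p, lker (tangent_map F p) = 0%VS.

(** * Semi-Riemannian metrics and their Levi-Civita connection *)

Definition nondegenerate_on (R : realType) (V : vectType R)
    (b : {symmetric V}) (W : {vspace V}) : Prop :=
  (W :&: orthov b W)%VS = 0%VS.

Definition negative_definite_on (R : realType) (V : vectType R)
    (b : {symmetric V}) (W : {vspace V}) : Prop :=
  forall v, v \in W -> v != 0 -> b v v < 0.

Definition has_index (R : realType) (V : vectType R)
    (b : {symmetric V}) (nu : nat) : Prop :=
  (exists2 W : {vspace V}, negative_definite_on b W & \dim W = nu) /\
  (forall W : {vspace V}, negative_definite_on b W -> (\dim W <= nu)%N).

Definition metric_field (R : realType) (d : nat) (N : manifold R d) : Type :=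
  forall p : N, {symmetric (tangent p)}.

Definition semi_riemannian (R : realType) (d : nat) (N : manifold R d)
    (nu : nat) (g : metric_field N) : Prop :=
  [/\ forall p, nondegenerate (g p),
      forall p, has_index (g p) nu
    & forall (A : set N) (X Y : vector_field N), open A ->
        smooth_field A X -> smooth_field A Y ->
        smooth_fun A (fun p => g p (X p) (Y p))].

(* [D p v Y] is the covariant derivative at [p] of [Y] along [v]; it is only
   meaningful when [Y] is smooth near [p]. *)
Definition covariant_derivative (R : realType) (d : nat) (N : manifold R d) :
    Type :=
  forall p : N, tangent p -> vector_field N -> tangent p.

Record affine_connection (R : realType) (d : nat) (N : manifold R d)
    (D : covariant_derivative N) : Prop := AffineConnection {
  conn_linear : forall (A : set N) (Y : vector_field N) (p : N) (a : R)
      (u v : tangent p), open A -> A p -> smooth_field A Y ->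
    D p (a *: u + v) Y = a *: D p u Y + D p v Y;
  conn_add : forall (A : set N) (Y Z : vector_field N) (p : N)
      (v : tangent p), open A -> A p ->
      smooth_field A Y -> smooth_field A Z ->
    D p v (fun q => Y q + Z q) = D p v Y + D p v Z;
  conn_leibniz : forall (A : set N) (f : N -> R) (Y : vector_field N) (p : N)
      (v : tangent p), open A -> A p -> smooth_fun A f -> smooth_field A Y ->
    D p v (fun q => f q *: Y q) = dirder v f *: Y p + f p *: D p v Y;
  conn_smooth : forall (A : set N) (X Y : vector_field N), open A ->
      smooth_field A X -> smooth_field A Y ->
    smooth_field A (fun p => D p (X p) Y) }.

(* Torsion-freeness is stated through the action on functions:
   [X, Y] f = X (Y f) - Y (X f). *)
Record levi_civita (R : realType) (d : nat) (N : manifold R d)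
    (g : metric_field N) (D : covariant_derivative N) : Prop := LeviCivita {
  lc_connection : affine_connection D;
  lc_torsion_free : forall (A : set N) (X Y : vector_field N) (f : N -> R)
      (p : N), open A -> A p ->
      smooth_field A X -> smooth_field A Y -> smooth_fun A f ->
    dirder (D p (X p) Y - D p (Y p) X) f =
    dirder (X p) (fun q => dirder (Y q) f) -
    dirder (Y p) (fun q => dirder (X q) f);
  lc_metric : forall (A : set N) (X Y Z : vector_field N) (p : N),
      open A -> A p ->
      smooth_field A X -> smooth_field A Y -> smooth_field A Z ->
    dirder (X p) (fun q => g q (Y q) (Z q)) =
    g p (D p (X p) Y) (Z p) + g p (Y p) (D p (X p) Z) }.

(** * Indefinite Sasakian manifolds *)

Record indefinite_sasakian (R : realType) (d : nat) (N : manifold R d)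
    (nu : nat) (phi : forall p : N, 'End(tangent p)) (zeta : vector_field N)
    (eta : forall p : N, {scalar (tangent p)}) (g : metric_field N)
    (D : covariant_derivative N) : Prop := IndefiniteSasakian {
  sas_odd : odd d;
  sas_index : (0 < nu)%N;
  sas_metric : semi_riemannian nu g;
  sas_levi_civita : levi_civita g D;
  sas_phi_smooth : forall (A : set N) (X : vector_field N), open A ->
    smooth_field A X -> smooth_field A (fun p => phi p (X p));
  sas_zeta_smooth : smooth_field [set: N] zeta;
  sas_eta_smooth : forall (A : set N) (X : vector_field N), open A ->
    smooth_field A X -> smooth_fun A (fun p => eta p (X p));
  sas_phi2 : forall p (v : tangent p),
    phi p (phi p v) = - v + eta p v *: zeta p;
  sas_phi_zeta : forall p, phi p (zeta p) = 0;
  sas_eta_phi : forall p (v : tangent p), eta p (phi p v) = 0;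
  sas_eta_zeta : forall p, eta p (zeta p) = 1;
  sas_compatible : forall p (u v : tangent p),
    g p (phi p u) (phi p v) = g p u v - eta p u * eta p v;
  sas_eta_dual : forall p (v : tangent p), eta p v = g p (zeta p) v;
  sas_nabla_phi : forall (A : set N) (X Y : vector_field N) (p : N),
      open A -> A p -> smooth_field A X -> smooth_field A Y ->
    D p (X p) (fun q => phi q (Y q)) - phi p (D p (X p) Y) =
    g p (X p) (Y p) *: zeta p - eta p (Y p) *: X p }.

(** * Vector fields along an immersion *)

Definition field_along (R : realType) (m d : nat) (M : manifold R m)
    (N : manifold R d) (iota : M -> N) : Type :=
  forall p : M, tangent (iota p).

Definition bundle_along (R : realType) (m d : nat) (M : manifold R m)
    (N : manifold R d) (iota : M -> N) : Type :=
  forall p : M, {vspace (tangent (iota p))}.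

Definition local_extension (R : realType) (m d : nat) (M : manifold R m)
    (N : manifold R d) (iota : M -> N) (p : M) (Y : field_along iota)
    (Z : vector_field N) : Prop :=
  (exists A : set N, [/\ open A, A (iota p) & smooth_field A Z]) /\
  (\forall q \near p, Z (iota q) = Y q).

(* For an immersion [iota], which is locally an embedding, a field along
   [iota] is smooth iff it extends locally to a smooth field of [N]. *)
Definition smooth_along (R : realType) (m d : nat) (M : manifold R m)
    (N : manifold R d) (iota : M -> N) (U : set M) (Y : field_along iota) :
    Prop :=
  forall p, U p -> exists Z, local_extension p Y Z.

Definition section_of (R : realType) (m d : nat) (M : manifold R m)
    (N : manifold R d) (iota : M -> N) (E : bundle_along iota) (U : set M)
    (Y : field_along iota) : Prop :=
  smooth_along U Y /\ forall p, U p -> Y p \in E p.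

Definition local_frame (R : realType) (m d : nat) (M : manifold R m)
    (N : manifold R d) (iota : M -> N) (E : bundle_along iota) (k : nat)
    (U : set M) (e : 'I_k -> field_along iota) : Prop :=
  (forall i, smooth_along U (e i)) /\
  (forall p, U p -> basis_of (E p) [seq e i p | i : 'I_k]).

Definition smooth_bundle (R : realType) (m d : nat) (M : manifold R m)
    (N : manifold R d) (iota : M -> N) (k : nat) (E : bundle_along iota) :
    Prop :=
  forall p, exists U (e : 'I_k -> field_along iota),
    [/\ open U, U p & local_frame E U e].

Definition subbundle (R : realType) (m d : nat) (M : manifold R m)
    (N : manifold R d) (iota : M -> N) (k : nat) (E F : bundle_along iota) :
    Prop :=
  smooth_bundle k E /\ forall p, (E p <= F p)%VS.

(** * Null submanifolds *)

(* [TM], regarded as a subbundle of [TN] along [iota]. *)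
Definition tangent_bundle (R : realType) (m d : nat) (M : manifold R m)
    (N : manifold R d) (iota : M -> N) : bundle_along iota :=
  fun p => limg (tangent_map iota p).

Definition radical (R : realType) (m d : nat) (M : manifold R m)
    (N : manifold R d) (iota : M -> N) (g : metric_field N) :
    bundle_along iota :=
  fun p => (tangent_bundle iota p
            :&: orthov (g (iota p)) (tangent_bundle iota p))%VS.

Definition null_submanifold (R : realType) (m d : nat) (M : manifold R m)
    (N : manifold R d) (iota : M -> N) (g : metric_field N) (r : nat) :
    Prop :=
  [/\ immersion iota, (0 < r)%N & smooth_bundle r (radical iota g)].

Definition coisotropic_null_submanifold (R : realType) (m n r d : nat)
    (M : manifold R m) (N : manifold R d) (iota : M -> N)
    (g : metric_field N) : Prop :=
  [/\ [/\ (1 <= m)%N, (1 <= n)%N & d = (m + n)%N],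
      null_submanifold iota g r
    & [/\ (1 <= r)%N, r = n & (n < m)%N]].

(* The summands of [TM = Rad TM + S] are orthogonal by definition of
   [Rad TM]. *)
Definition screen_distribution (R : realType) (m d r : nat)
    (M : manifold R m) (N : manifold R d) (iota : M -> N)
    (g : metric_field N) (S : bundle_along iota) : Prop :=
  subbundle (m - r) S (tangent_bundle iota) /\
  forall p, [/\ tangent_bundle iota p = (radical iota g p + S p)%VS,
                (radical iota g p :&: S p)%VS = 0%VS
              & nondegenerate_on (g (iota p)) (S p)].

Definition screen_proj (R : realType) (m d : nat) (M : manifold R m)
    (N : manifold R d) (iota : M -> N) (g : metric_field N)
    (S : bundle_along iota) (Y : field_along iota) : field_along iota :=
  fun p => daddv_pi (S p) (radical iota g p) (Y p).

Record null_frame (R : realType) (m d r : nat) (M : manifold R m)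
    (N : manifold R d) (iota : M -> N) (g : metric_field N)
    (S ltr : bundle_along iota) (U : set M)
    (xi nv : 'I_r -> field_along iota) : Prop := NullFrame {
  nf_radical : local_frame (radical iota g) U xi;
  nf_transversal : local_frame ltr U nv;
  nf_screen : forall i p, U p -> nv i p \in orthov (g (iota p)) (S p);
  nf_dual : forall i j p, U p -> g (iota p) (xi i p) (nv j p) = (i == j)%:R;
  nf_null : forall i j p, U p -> g (iota p) (nv i p) (nv j p) = 0 }.

Definition null_transversal_bundle (R : realType) (m d r : nat)
    (M : manifold R m) (N : manifold R d) (iota : M -> N)
    (g : metric_field N) (S ltr : bundle_along iota) : Prop :=
  forall p, exists U (xi nv : 'I_r -> field_along iota),
    [/\ coordinate_nbhd U, U p & null_frame g S ltr U xi nv].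

Record tangent_to_zeta (R : realType) (m d r : nat) (M : manifold R m)
    (N : manifold R d) (iota : M -> N)
    (phi : forall p : N, 'End(tangent p)) (zeta : vector_field N)
    (g : metric_field N) (S ltr : bundle_along iota) : Prop :=
  TangentToZeta {
  tz_tangent : forall p, zeta (iota p) \in tangent_bundle iota p;
  tz_screen : forall p, zeta (iota p) \in S p;
  tz_phi_radical :
    subbundle r (fun p => (phi (iota p) @: radical iota g p)%VS) S;
  tz_phi_transversal :
    subbundle r (fun p => (phi (iota p) @: ltr p)%VS) S;
  tz_decomposition : exists k (D0 : bundle_along iota), smooth_bundle k D0 /\
    forall p,
      let F := (phi (iota p) @: radical iota g p)%VS in
      let L := (phi (iota p) @: ltr p)%VS in
      let b := g (iota p) in
      [/\ S p = (F + L + D0 p + <[zeta (iota p)]>)%VS,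
          directv (F + L + D0 p + <[zeta (iota p)]>)%VS,
          (D0 p <= orthov b (F + L))%VS
            /\ zeta (iota p) \in orthov b (F + L + D0 p)%VS,
          nondegenerate_on b (D0 p)
        & (phi (iota p) @: D0 p <= D0 p)%VS] }.

(* The Gauss formulas over [U]: [nablaM] and [nablaS] are the induced
   connections of [M] and of [S], and [hl i], [hs i] are the local null
   fundamental forms of [M] and the local second fundamental forms of [S].
   The ambient derivative of a field [Y] along [iota] is computed from any local
   extension [Z] of [Y]. *)
Definition gauss_formulas (R : realType) (m d r : nat) (M : manifold R m)
    (N : manifold R d) (iota : M -> N) (g : metric_field N)
    (D : covariant_derivative N) (S : bundle_along iota) (U : set M)
    (xi nv : 'I_r -> field_along iota)
    (nablaM nablaS : field_along iota -> field_along iota -> field_along iota)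
    (hl hs : 'I_r -> field_along iota -> field_along iota -> M -> R) : Prop :=
  forall X Y : field_along iota,
    section_of (tangent_bundle iota) U X ->
    section_of (tangent_bundle iota) U Y ->
    let PY := screen_proj g S Y in
    [/\ section_of (tangent_bundle iota) U (nablaM X Y),
        section_of S U (nablaS X PY),
        forall p Z, U p -> local_extension p Y Z ->
          D (iota p) (X p) Z = nablaM X Y p + \sum_i hl i X Y p *: nv i p
      & forall p, U p ->
          nablaM X PY p = nablaS X PY p + \sum_i hs i X PY p *: xi i p].

Definition screen_conformal_on (R : realType) (m d r : nat)
    (M : manifold R m) (N : manifold R d) (iota : M -> N)
    (g : metric_field N) (D : covariant_derivative N)
    (S : bundle_along iota) (U : set M)
    (xi nv : 'I_r -> field_along iota) : Prop :=
  exists nablaM nablaS hl hs (vphi : 'I_r -> M -> R),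
    [/\ gauss_formulas g D S U xi nv nablaM nablaS hl hs,
        forall i, smooth_fun U (vphi i)
      & forall i (X Y : field_along iota) p,
          section_of (tangent_bundle iota) U X ->
          section_of (tangent_bundle iota) U Y -> U p ->
          hs i X (screen_proj g S Y) p = vphi i p * hl i X Y p].

Definition screen_locally_conformal (R : realType) (m d r : nat)
    (M : manifold R m) (N : manifold R d) (iota : M -> N)
    (g : metric_field N) (D : covariant_derivative N)
    (S ltr : bundle_along iota) : Prop :=
  forall p, exists U (xi nv : 'I_r -> field_along iota),
    [/\ coordinate_nbhd U, U p, null_frame g S ltr U xi nv
      & screen_conformal_on g D S U xi nv].

(* Main.v *)
Require Import Defs.
From HB Require Import structures.
From mathcomp Require Import all_boot all_order all_algebra.
From mathcomp Require Import sesquilinear.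
From mathcomp Require Import all_classical all_reals all_analysis.

(** The obstruction is the covariant derivative of the structure field.
    Differentiating [phi zeta = 0] with the Sasakian identity for the derivative
    of [phi] gives [D_X zeta = - phi X] ([nabla_zeta]).  As [zeta] is a section
    of the screen, both Gauss formulas apply to it, and together they split
    [- phi X] into a screen part, a radical part with coefficients
    [hs i X zeta], and a transversal part with coefficients [hl i X zeta].
    Pairing with the dual null frames isolates these coefficients
    ([null_frame_coefficients]):

      [hl i X zeta = - g (phi X) (xi i)], [hs i X zeta = - g (phi X) (nv i)]

    ([fundamental_forms_zeta]).  At [X = phi (xi i)] one has
    [- phi X = xi i], because [eta] vanishes on the radical; so the first value
    is [g (xi i) (xi i) = 0] and the second is [g (xi i) (nv i) = 1].  No
    conformal factor can satisfy [1 = varphi * 0].  The contradiction already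
    appears at a single point and for a single index. *)

Set Implicit Arguments.
Unset Strict Implicit.
Unset Printing Implicit Defensive.

Import Order.TTheory GRing.Theory Num.Theory.
Import numFieldNormedType.Exports.

Local Open Scope classical_set_scope.
Local Open Scope ring_scope.

Lemma symmetric_formC (R : realType) (V : vectType R) (b : {symmetric V})
  (u v : V) : b u v = b v u.
Proof. by rewrite hermC expr0 mul1r. Qed.

Lemma Ck_subset (R : realType) (V W : normedModType R) k (A B : set V)
  (f : V -> W) : A `<=` B -> Ck k B f -> Ck k A f.
Proof.
move=> sAB; elim: k f => [|k IHk] f /= => [cf x /sAB/cf //|[df cf]].
by split=> [x /sAB/df //|v]; apply: IHk.
Qed.

Lemma smooth_field_subset (R : realType) (d : nat) (N : manifold R d)
  (A B : set N) (X : vector_field N) :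
  A `<=` B -> smooth_field B X -> smooth_field A X.
Proof.
move=> sAB sX c cN k; apply: Ck_subset (sX c cN k).
by apply: image_subset => q [/sAB Bq cq].
Qed.

Lemma dirder_cst (R : realType) (d : nat) (N : manifold R d) (p : N)
  (v : tangent p) (a : R) : dirder v (fun=> a) = 0.
Proof. by rewrite /dirder (_ : _ \o _ = cst a) // diff_cst. Qed.

(** Additivity suffices: the zero field is its own double. *)
Lemma connection0 (R : realType) (d : nat) (N : manifold R d)
  (D : covariant_derivative N) (A : set N) (p : N) (v : tangent p) :
  affine_connection D -> open A -> A p ->
  smooth_field A (fun q => 0 : tangent q) -> D p v (fun q => 0) = 0.
Proof.
move=> hD oA Ap s0; have := conn_add hD v oA Ap s0 s0.
rewrite (_ : (fun q : N => 0 + 0 : tangent q) = (fun q => 0)); last first.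
  by apply/functional_extensionality_dep => q; rewrite addr0.
by move/eqP; rewrite -[X in X == _]addr0 (inj_eq (addrI _)) => /eqP <-.
Qed.

Lemma memv_radical (R : realType) (m d : nat) (M : manifold R m)
  (N : manifold R d) (iota : M -> N) (g : metric_field N) (p : M)
  (u : tangent (iota p)) :
  u \in radical iota g p -> u \in tangent_bundle iota p /\
    forall v, v \in tangent_bundle iota p -> g (iota p) u v = 0.
Proof. by rewrite memv_cap => /andP[uT /mem_orthovP]. Qed.

Lemma null_frame_radical (R : realType) (m d r : nat) (M : manifold R m)
  (N : manifold R d) (iota : M -> N) (g : metric_field N)
  (S ltr : bundle_along iota) (U : set M) (xi nv : 'I_r -> field_along iota)
  (i : 'I_r) (p : M) :
  null_frame g S ltr U xi nv -> U p -> xi i p \in radical iota g p.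
Proof.
move=> hF Up; have [_ /(_ p Up)/basis_mem] := nf_radical hF; apply.
by apply/mapP; exists i => //; rewrite mem_enum.
Qed.

Section Sasakian.
Context (R : realType) (d nu : nat) (N : manifold R d)
  (phi : forall p : N, 'End(tangent p)) (zeta : vector_field N)
  (eta : forall p : N, {scalar (tangent p)}) (g : metric_field N)
  (D : covariant_derivative N)
  (hN : indefinite_sasakian nu phi zeta eta g D).
Arguments D : clear implicits.

Lemma nabla_zeta_orthogonal (A : set N) (X : vector_field N) (p : N) :
  open A -> A p -> smooth_field A X -> g p (zeta p) (D p (X p) zeta) = 0.
Proof.
move=> oA Ap sX.
have sz : smooth_field A zeta by apply: smooth_field_subset (sas_zeta_smooth hN).
have := lc_metric (sas_levi_civita hN) oA Ap sX sz sz.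
rewrite (_ : (fun q => g q (zeta q) (zeta q)) = fun=> 1); last first.
  by apply/funext => q; rewrite -(sas_eta_dual hN) (sas_eta_zeta hN).
rewrite dirder_cst [X in X + _]symmetric_formC -mulr2n => /esym/eqP.
by rewrite mulrn_eq0 /= => /eqP.
Qed.

(** Differentiating [phi zeta = 0] gives [phi (D_X zeta) = X - eta X zeta]; the
    inverse of [phi] on the orthogonal of [zeta] is [- phi], and the unit length
    of [zeta] keeps [D_X zeta] in that orthogonal. *)
Lemma nabla_zeta (A : set N) (X : vector_field N) (p : N) :
  open A -> A p -> smooth_field A X -> D p (X p) zeta = - phi p (X p).
Proof.
move=> oA Ap sX.
have sz : smooth_field A zeta by apply: smooth_field_subset (sas_zeta_smooth hN).
have phiz0 : (fun q => phi q (zeta q)) = (fun q => 0 : tangent q).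
  by apply/functional_extensionality_dep => q; rewrite (sas_phi_zeta hN).
have := sas_nabla_phi hN oA Ap sX sz.
rewrite phiz0 (connection0 (A := A)) //; first last.
- by rewrite -phiz0; apply: (sas_phi_smooth hN).
- exact: lc_connection (sas_levi_civita hN).
rewrite (sas_eta_zeta hN) scale1r sub0r => /(congr1 (phi p)).
rewrite linearN linearB linearZ /= (sas_phi2 hN) (sas_phi_zeta hN) scaler0 sub0r.
rewrite (sas_eta_dual hN) (nabla_zeta_orthogonal oA Ap sX) scale0r addr0.
by rewrite opprK.
Qed.

Context (m r : nat) (M : manifold R m) (iota : M -> N).

Lemma smooth_along_phi (U : set M) (Y : field_along iota) :
  smooth_along U Y -> smooth_along U (fun p => phi (iota p) (Y p)).
Proof.
move=> sY p Up; have [Z [[A [oA Ap sZ]] ZY]] := sY p Up.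
exists (fun q => phi q (Z q)); split.
  by exists A; split=> //; apply: (sas_phi_smooth hN).
by apply: filterS ZY => q ->.
Qed.

Lemma zeta_local_extension (p : M) :
  local_extension p (fun q => zeta (iota q)) zeta.
Proof.
split; last exact: nearW.
exists [set: N]; split=> //; [exact: openT|exact: sas_zeta_smooth hN].
Qed.

Lemma nabla_zeta_along (U : set M) (X : field_along iota) (p : M) :
  smooth_along U X -> U p ->
  D (iota p) (X p) zeta = - phi (iota p) (X p).
Proof.
move=> sX Up; have [Z [[A [oA Ap sZ]] ZX]] := sX p Up.
by rewrite -(nbhs_singleton ZX) (nabla_zeta oA Ap sZ).
Qed.

Context (S ltr : bundle_along iota).

(** Screen vectors are orthogonal to both null frames, so pairing with one
    frame reads off the coefficients along the other. *)
Lemma null_frame_coefficients (U : set M) (xi nv : 'I_r -> field_along iota)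
  (p : M) (s : tangent (iota p)) (a b : 'I_r -> R) (j : 'I_r) :
  screen_distribution r g S -> null_frame g S ltr U xi nv -> U p -> s \in S p ->
  let w := s + \sum_i a i *: xi i p + \sum_i b i *: nv i p in
  g (iota p) w (nv j p) = a j /\ g (iota p) w (xi j p) = b j.
Proof.
move=> hS hF Up sS w.
have xiT i := (memv_radical (null_frame_radical i hF Up)).1.
have xi0 i := (memv_radical (null_frame_radical i hF Up)).2.
have sT : s \in tangent_bundle iota p by apply: (subvP (hS.1.2 p)).
have pick (c : 'I_r -> R) : \sum_i c i * (i == j)%:R = c j.
  rewrite (bigD1 j) //= eqxx mulr1 big1 ?addr0 // => i /negPf ->.
  exact: mulr0.
have pairing v : g (iota p) w v = g (iota p) s v +
    \sum_i a i * g (iota p) (xi i p) v + \sum_i b i * g (iota p) (nv i p) v.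
  rewrite /w !linearDl /= !linear_sumlz.
  by congr (_ + _ + _); apply: eq_bigr => i _; rewrite linearZl_LR.
have snv : g (iota p) s (nv j p) = 0.
  rewrite symmetric_formC; move: sS.
  by apply/mem_orthovP; exact: nf_screen hF j p Up.
split; rewrite pairing.
- rewrite snv add0r [X in _ + X]big1 ?addr0; last first.
    by move=> i _; rewrite (nf_null hF) // mulr0.
  by rewrite -[RHS]pick; apply: eq_bigr => i _; rewrite (nf_dual hF).
- rewrite symmetric_formC xi0 // add0r big1 ?add0r; last first.
    by move=> i _; rewrite xi0 // mulr0.
  rewrite -[RHS]pick; apply: eq_bigr => i _.
  by rewrite symmetric_formC (nf_dual hF) // eq_sym.
Qed.

Hypothesis hS : screen_distribution r g S.
Hypothesis hT : tangent_to_zeta r phi zeta g S ltr.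

Lemma screen_proj_zeta :
  screen_proj g S (fun p => zeta (iota p)) = (fun p => zeta (iota p)).
Proof.
apply/functional_extensionality_dep => p; apply: daddv_pi_id; last first.
  exact: tz_screen hT p.
by rewrite capvC; have [] := hS.2 p.
Qed.

(** The two local forms evaluated at [zeta] are the components of
    [- phi X = D_X zeta] along the transversal and the radical frame. *)
Lemma fundamental_forms_zeta (U : set M) (xi nv : 'I_r -> field_along iota)
  (nablaM nablaS : field_along iota -> field_along iota -> field_along iota)
  (hl hs : 'I_r -> field_along iota -> field_along iota -> M -> R)
  (X : field_along iota) (p : M) (j : 'I_r) :
  null_frame g S ltr U xi nv ->
  gauss_formulas g D S U xi nv nablaM nablaS hl hs ->
  section_of (tangent_bundle iota) U X -> U p ->
  hs j X (fun q => zeta (iota q)) p =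
    - g (iota p) (phi (iota p) (X p)) (nv j p) /\
  hl j X (fun q => zeta (iota q)) p =
    - g (iota p) (phi (iota p) (X p)) (xi j p).
Proof.
move=> hF hG hX Up.
have hZ : section_of (tangent_bundle iota) U (fun q => zeta (iota q)).
  split=> q Uq; last exact: tz_tangent hT q.
  by exists zeta; apply: zeta_local_extension.
have := hG X _ hX hZ; rewrite screen_proj_zeta => -[_ [_ sS] gM gS].
have := gM p _ Up (zeta_local_extension p).
rewrite (nabla_zeta_along hX.1 Up) gS // => phiX.
have [] := null_frame_coefficients (fun i => hs i X (fun q => zeta (iota q)) p)
  (fun i => hl i X (fun q => zeta (iota q)) p) j hS hF Up (sS p Up).
by rewrite /= -phiX !linearNl => -> ->.
Qed.

End Sasakian.

Theorem theorem3p3 (R : realType) (d nu : nat) (N : manifold R d)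
    (phi : forall p : N, 'End(tangent p)) (zeta : vector_field N)
    (eta : forall p : N, {scalar (tangent p)}) (g : metric_field N)
    (D : covariant_derivative N)
    (hN : indefinite_sasakian nu phi zeta eta g D) :
  ~ exists (m n r : nat) (M : manifold R m) (iota : M -> N)
      (S ltr : bundle_along iota),
      [/\ coisotropic_null_submanifold n r iota g,
          screen_distribution r g S,
          null_transversal_bundle r g S ltr,
          tangent_to_zeta r phi zeta g S ltr
        & screen_locally_conformal r g D S ltr].
Proof.
move=> [m [n [r [M [iota [S [ltr [hM hS _ hT hC]]]]]]]].
have [_ [_ r_gt0 _] _] := hM.
have [p _] := carrier_nonempty M.
have [U [xi [nv [_ Up hF [nablaM [nablaS [hl [hs [vphi [hG _ conf]]]]]]]]]] :=
  hC p.
pose j := Ordinal r_gt0.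
have [xiT xi0] := memv_radical (null_frame_radical j hF Up).
pose X : field_along iota := fun q => phi (iota q) (xi j q).
have hX : section_of (tangent_bundle iota) U X.
  split=> [|q Uq]; first exact: smooth_along_phi hN _ _ _ _ _ ((nf_radical hF).1 j).
  apply: (subvP (hS.1.2 q)); apply: (subvP ((tz_phi_radical hT).2 q)).
  exact: memv_img (null_frame_radical j hF Uq).
have gphiX v : g (iota p) (phi (iota p) (X p)) v = - g (iota p) (xi j p) v.
  rewrite -linearNl; congr (g _ _ _); rewrite (sas_phi2 hN) (sas_eta_dual hN) symmetric_formC xi0 ?scale0r ?addr0 //.
  exact: tz_tangent hT p.
have hZ : section_of (tangent_bundle iota) U (fun q => zeta (iota q)).
  split=> q Uq; last exact: tz_tangent hT q.
  by exists zeta; apply: (zeta_local_extension hN).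
have [] := fundamental_forms_zeta hN hS hT j hF hG hX Up.
have := conf j X _ p hX hZ Up; rewrite (screen_proj_zeta hS hT) => ->.
rewrite !gphiX !opprK (nf_dual hF) // eqxx xi0 // => eq1 eq0.
by move/eqP: eq1; rewrite eq0 mulr0 eq_sym oner_eq0.
Qed.
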